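(* Let $B(x)$ and $C(x)$ be given asymptotic series (as $x\to\infty$) $$B(x)\sim x^u\sum_{n=0}^\infty b_nx^{-n},\qquad C(x)\sim x^v\sum_{n=0}^\infty c_nx^{-n},$$ where $u,v$ are real numbers, $b_0\neq0$, $c_0\ne0$. Suppose $u\neq 0$. Then there exists an asymptotic series $$A(x)\sim x^w\sum_{n=0}^\infty a_nx^{-n},\qquad a_0\neq 0,\quad w>0,$$ such that $B(A(x))=C(x)$ if and only if the following conditions are satisfied: (1) $u$ and $v$ have the same sign and $w=v/u$ is a rational number; (2) for every $n\ge1$, if $nw$ is not a positive integer then $b_n=0$; (3) $b_0$ and $c_0$ are of the same sign. In that case, the coefficients of the series $A(x)$ can be calculated using the following algorithm: $$a_0=(c_0/b_0)^{1/u},$$ and for $n\ge1$ $$a_n=-\frac{a_0}{b_0\,u\,P_0(u)}\left[\sum_{j=1}^{\lfloor n/w\rfloor}b_jP_{n-wj}(u-j)+\frac{b_0}{n a_0}\sum_{k=1}^{n-1}[k(1+u)-n]\,a_k\,P_{n-k}(u)-c_n\right],$$ where, for real $r$, $P_0(r)=a_0^r$ and $P_n(r)=\frac1{na_0}\sum_{k=1}^n[k(1+r)-n]\,a_k\,P_{n-k}(r)$ for $n\ge1$.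
   Context: All series are asymptotic power series with real coefficients as $x\to+\infty$; the exponents $u,v,w$ are real. The equation $B(A(x))=C(x)$ is understood as equality of asymptotic expansions: the series $\sum_{j\ge0} b_j (A(x))^{u-j}=\sum_{j\ge 0} b_jx^{w(u-j)}\bigl(\sum_{k\ge0}a_kx^{-k}\bigr)^{u-j}$, expanded in powers of $x$, coincides with $x^v\sum_{n\ge0}c_nx^{-n}$. Since the expansion of $B$ is at $+\infty$ and real powers of $A(x)$ are taken, $A(x)$ is positive for large $x$, i.e. $a_0>0$. For real $r$, the numbers $P_n(r)$ are the coefficients of the real power of a series: $\bigl(\sum_{k\ge0}a_kx^{-k}\bigr)^r\sim\sum_{n\ge0}P_n(r)x^{-n}$; $P_n(r)$ depends only on $a_0,\dots,a_n$ and $r$, and satisfies the recursion given in the claim. In the sum over $j$ in the formula for $a_n$, terms with $b_j=0$ are taken to be zero (so $P_{n-wj}$ occurs only when $wj$ is an integer).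
   Formalization: Condition (1) requires w=v/u to be rational only if some b_n with n≥1 is nonzero; as stated, necessity fails for B(x)=x, C(x)=x^{√2}, where A(x)=x^{√2} is a solution with irrational w. *)

(* Defs.v *)
From mathcomp Require Import all_boot all_order all_algebra.
From mathcomp Require Import all_classical all_reals exp.
Set Implicit Arguments.
Unset Strict Implicit.
Unset Printing Implicit Defensive.
Import Order.TTheory GRing.Theory Num.Theory.
Local Open Scope classical_set_scope.
Local Open Scope ring_scope.

(* The series x^v (c 0 + c 1 x^-1 + c 2 x^-2 + ...) is represented by its
   exponent v : R and its coefficient sequence c : nat -> R. *)

Definition gbin (R : realType) (r : R) (m : nat) : R :=
  (\prod_(i < m) (r - i%:R)) / (m`!)%:R.

(* P_n(r): coefficient of x^-n in (a 0 + a 1 x^-1 + ...)^r, for a 0 > 0, from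
   the binomial series of a_0^r (1 + t)^r with t = \sum_(k >= 1) (a_k/a_0) X^k
   and X = x^-1. As t has no constant term, only t truncated at degree n, and
   only the powers t^m with m <= n, contribute to the coefficient of X^n. *)
Definition powcoef (R : realType) (a : nat -> R) (r : R) (n : nat) : R :=
  a 0%N `^ r *
  \sum_(m < n.+1)
    gbin r m * ((\sum_(1 <= k < n.+1) (a k / a 0%N) *: 'X^k) ^+ m)`_n.

(* Coefficient of x^e in x^v \sum_n c_n x^-n. *)
Definition series_at (R : realType) (v : R) (c : nat -> R) (e : R) : R :=
  \sum_(n \in [set n : nat | v - n%:R = e]) c n.

(* Coefficient of x^e in \sum_j b_j x^(w(u-j)) (\sum_k a_k x^-k)^(u-j). For
   w > 0 only finitely many pairs (j, m) satisfy w(u-j) - m = e. *)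
Definition comp_at (R : realType) (u : R) (b : nat -> R) (w : R) (a : nat -> R)
    (e : R) : R :=
  \sum_(p \in [set p : nat * nat | w * (u - p.1%:R) - p.2%:R = e])
    b p.1 * powcoef a (u - p.1%:R) p.2.

(* A(x) ~ x^w \sum_n a_n x^-n, with w > 0, solves B(A(x)) = C(x). The leading
   coefficient is positive, not only nonzero, because real powers of A(x) are
   taken as x -> +oo. *)
Definition solves (R : realType) (u : R) (b : nat -> R) (v : R) (c : nat -> R)
    (w : R) (a : nat -> R) : Prop :=
  [/\ 0 < w, 0 < a 0%N & forall e : R, comp_at u b w a e = series_at v c e].

Definition is_rational (R : realType) (x : R) : Prop :=
  exists q : rat, x = ratr q.

Definition is_pos_integer (R : realType) (x : R) : Prop :=
  exists2 k : nat, (0 < k)%N & x = k%:R.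

(* Main.v *)
Require Import Defs.
From mathcomp Require Import all_boot all_order all_algebra.
From mathcomp Require Import all_classical all_reals exp.
From mathcomp Require Import ring lra.
Import Order.TTheory GRing.Theory Num.Theory.
Local Open Scope ring_scope.

(** Substituting A into B and comparing coefficients reduces the problem to a
    triangular system.

    The highest power of x in B(A(x)) is x^(w u), with coefficient b_0 a_0^u,
    and this forces v = w u and b_0 a_0^u = c_0; that fixes w, a_0 and the two
    sign conditions ([solves_leading]).  If some b_n with w n not an integer
    were nonzero, the least such n would contribute b_n a_0^(u-n) to the power
    x^(w (u-n)), which no other term reaches and which does not occur in C;
    hence w j is an integer whenever b_j <> 0 ([solves_integral]).  One nonzero
    b_n with n >= 1 then makes w a quotient of integers.

    Once w j is an integer whenever b_j <> 0, all exponents on both sides have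
    the form v - n, and B(A) = C becomes, for every n, the equation
      sum_(w j <= n) b_j P_(n - w j)(u - j) = c_n
    ([solvesP]).  For n >= 1 the unknown a_n enters only through the term j = 0,
    that is through P_n(u), and it enters linearly with the nonzero coefficient
    u a_0^(u-1): solving for it gives the stated formula ([next_coefP]).  The
    right-hand side involves only a_0, ..., a_(n-1) ([next_coef_local]), so the
    formula also defines a solution by recursion ([solves_exists]).

    The linear occurrence of a_n in P_n(u) is read off the recursion for P_n(r)
    ([powcoef_rec]).  That recursion is the identity
    f (f^r)' = r f' f^r compared coefficient by coefficient; for the truncated
    binomial series it holds up to an error term of high order
    ([binpoly_ode]). *)

(** * Real powers of a series *)

Lemma coef_exp_trunc {K : nzSemiRingType} (p q : {poly K}) (n : nat) :
  (forall i, (i <= n)%N -> p`_i = q`_i) ->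
  forall m i, (i <= n)%N -> (p ^+ m)`_i = (q ^+ m)`_i.
Proof.
move=> pq; elim=> [|m IH] i lein; first by rewrite !expr0.
rewrite !exprS !coefM; apply: eq_bigr => j _.
by rewrite pq ?IH // (leq_trans _ lein) // ?leq_subr // -ltnS.
Qed.

Lemma coef_exp_val {K : nzSemiRingType} (p : {poly K}) :
  p`_0 = 0 -> forall m i, (i < m)%N -> (p ^+ m)`_i = 0.
Proof.
move=> p0; elim=> // m IH i; rewrite ltnS => leim.
rewrite exprS coefM big1 // => -[[|j] /= ltji] _; first by rewrite p0 mul0r.
rewrite IH ?mulr0 // (leq_trans _ leim) // ltn_subrL /=.
exact: leq_ltn_trans (leq0n j) ltji.
Qed.

Lemma gbinS {R : realType} (r : R) (m : nat) :
  m.+1%:R * gbin r m.+1 = (r - m%:R) * gbin r m.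
Proof.
rewrite /gbin big_ord_recr /= factS natrM.
have h1 : (m.+1)%:R != 0 :> R by rewrite pnatr_eq0.
have h2 : (m`!)%:R != 0 :> R by rewrite pnatr_eq0 -lt0n fact_gt0.
by field; rewrite h2 nat1r h1.
Qed.

Definition binpoly {R : realType} (r : R) (N : nat) (t : {poly R}) : {poly R} :=
  \sum_(m < N.+1) gbin r m *: t ^+ m.

(** The truncated form of (1 + t) S' = r t' S for S = (1 + t)^r: in the
    differentiated sum the terms telescope by [gbinS], leaving only a boundary
    term, which is divisible by t^N. *)
Lemma binpoly_ode {R : realType} (r : R) (t : {poly R}) (N : nat) :
  (1 + t) * (binpoly r N t)^`() =
  r *: (t^`() * binpoly r N t)
  - (N.+1%:R * gbin r N.+1) *: (t ^+ N * t^`()).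
Proof.
elim: N => [|N IH].
  rewrite /binpoly big_ord_recl big_ord0 addr0 expr0 derivZ.
  have -> : (1 : {poly R})^`() = 0 by rewrite -polyC1 derivC.
  rewrite gbinS subr0 scaler0 mulr0 mul1r -scalerAr scalerA mulr1 subrr //.
have E : binpoly r N.+1 t = binpoly r N t + gbin r N.+1 *: t ^+ N.+1.
  by rewrite /binpoly big_ord_recr.
rewrite E derivD mulrDr IH derivZ deriv_exp /= (gbinS _ N.+1).
rewrite -!mul_polyC !rmorphM !rmorphB /=.
rewrite !polyC_natr -mulr_natr exprS.
ring.
Qed.

(** The polynomial written t in the comments on [powcoef]: the series divided
    by a_0, minus 1, up to degree n. *)
Definition ratpoly {R : realType} (a : nat -> R) (n : nat) : {poly R} :=
  \sum_(1 <= k < n.+1) (a k / a 0%N) *: 'X^k.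

Lemma coef_ratpoly {R : realType} (a : nat -> R) (n i : nat) :
  (ratpoly a n)`_i = if (0 < i <= n)%N then a i / a 0%N else 0.
Proof. by rewrite /ratpoly coef_sumMXn big_nat1_eq. Qed.

Lemma powcoef_ext {R : realType} (a a' : nat -> R) (r : R) (n : nat) :
  (forall i, (i <= n)%N -> a i = a' i) -> powcoef a r n = powcoef a' r n.
Proof.
move=> aa'; rewrite /powcoef aa' //; congr (_ * _).
apply: eq_bigr => m _.
rewrite (eq_big_nat _ _ (F2 := fun k => (a' k / a' 0%N) *: 'X^k)) //.
by move=> k /andP[_ lekn]; rewrite aa'.
Qed.

(** [powcoef] truncates at the degree of the coefficient it computes.  Its
    values up to n can all be read in a single polynomial, because t has no
    constant term: neither the powers t^m with m > i nor the coefficients of t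
    beyond i reach degree i. *)
Lemma powcoef_binpoly {R : realType} (a : nat -> R) (r : R) (n i : nat) :
  (i <= n)%N -> powcoef a r i = a 0%N `^ r * (binpoly r n (ratpoly a n))`_i.
Proof.
move=> lein; rewrite /powcoef /binpoly coef_sum; congr (_ * _).
rewrite -/(ratpoly a i).
rewrite -(big_mkord xpredT (fun m => gbin r m * (ratpoly a i ^+ m)`_i)).
rewrite -(big_mkord xpredT (fun m => (gbin r m *: ratpoly a n ^+ m)`_i)).
rewrite [RHS](big_cat_nat (n := i.+1)) //= [X in _ + X]big_nat_cond.
rewrite [X in _ + X]big1 ?addr0; last first.
  move=> m /andP[/andP[ltim _] _].
  by rewrite coefZ coef_exp_val ?mulr0 // coef_ratpoly.
apply: eq_bigr => m _; rewrite coefZ; congr (_ * _).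
apply: (@coef_exp_trunc _ _ _ i) => // j leji.
by rewrite !coef_ratpoly leji (leq_trans leji lein).
Qed.

Lemma powcoef0 {R : realType} (a : nat -> R) (r : R) :
  powcoef a r 0 = a 0%N `^ r.
Proof.
rewrite /powcoef big_ord_recl big_ord0 expr0 coef1 /gbin big_ord0 fact0.
by rewrite divr1 !mulr1 addr0 mulr1.
Qed.

(** Coefficient of X^n in X times the differential equation of
    [binpoly_ode] at truncation order n. *)
Lemma powcoef_rec {R : realType} (a : nat -> R) (r : R) (n : nat) :
  a 0%N != 0 -> (0 < n)%N ->
  powcoef a r n = (n%:R * a 0%N)^-1 *
    \sum_(1 <= k < n.+1) (k%:R * (1 + r) - n%:R) * a k * powcoef a r (n - k).
Proof.
move=> a0 n0.
have n0' : n%:R != 0 :> R by rewrite pnatr_eq0 -lt0n.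
set t := ratpoly a n; set S := binpoly r n t.
have t0 : t`_0 = 0 by rewrite coef_ratpoly.
(* X d/dX acts on coefficients as multiplication by the index, without the
   shift that the plain derivative causes. *)
pose theta (p : {poly R}) := 'X * p^`().
have thetaE p i : (theta p)`_i = i%:R * p`_i.
  by rewrite coefXM; case: i => [|i]; rewrite ?mul0r // coef_deriv /= mulr_natl.
have ode : (1 + t) * theta S =
    r *: (theta t * S) - (n.+1%:R * gbin r n.+1) *: (t ^+ n * theta t).
  rewrite /theta mulrCA binpoly_ode -/S mulrBr -!scalerAr.
  by rewrite [X in _ - _ *: X]mulrCA (mulrA _ _ S).
(* t^n has no term below degree n and theta t has no constant term, so the
   error has no term below degree n + 1. *)
have err : (t ^+ n * theta t)`_n = 0.
  rewrite coefM big1 // => j _; rewrite thetaE.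
  have [ltjn|lenj] := ltnP j n; first by rewrite coef_exp_val ?mul0r.
  have -> : (n - j = 0)%N by apply/eqP; rewrite subn_eq0.
  by rewrite mul0r mulr0.
have := congr1 (fun p : {poly R} => p`_n) ode.
rewrite coefB !coefZ err mulr0 subr0 mulrDl mul1r coefD thetaE => main.
have {}main : n%:R * S`_n =
    \sum_(1 <= k < n.+1) (k%:R * (1 + r) - n%:R) * t`_k * S`_(n - k).
  move/eqP: main; rewrite -subr_eq0 -addrA addr_eq0 => /eqP ->.
  rewrite !coefM -(big_mkord xpredT (fun k => t`_k * (theta S)`_(n - k))).
  rewrite -(big_mkord xpredT (fun k => (theta t)`_k * S`_(n - k))).
  rewrite !(@big_ltn _ _ _ 0%N n.+1) // t0 mul0r add0r.
  rewrite [(theta t)`_0]thetaE !mul0r add0r.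
  rewrite big_distrr /= opprB -sumrB; apply: eq_big_nat => k /andP[_ lekn].
  by rewrite !thetaE natrB //; ring.
rewrite (@powcoef_binpoly _ _ _ n n) // -/t -/S.
have -> : S`_n = n%:R^-1 * (n%:R * S`_n) by rewrite mulKf.
rewrite main mulrCA [in RHS]invfM -mulrA; congr (_ * _).
rewrite !big_distrr /=; apply: eq_big_nat => k /andP[k0 lekn].
rewrite (@powcoef_binpoly _ _ _ n) ?leq_subr // -/t -/S.
rewrite coef_ratpoly k0 -ltnS lekn.
by rewrite /=; field.
Qed.

(** * Coefficients of the two sides *)

Lemma series_at_nat {R : realType} (v : R) (c : nat -> R) (n : nat) :
  series_at v c (v - n%:R) = c n.
Proof.
rewrite /series_at.
have -> : [set k : nat | v - k%:R = v - n%:R]%classic = [set n]%classic.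
  apply/seteqP; split => k /=; last by move=> ->.
  by move/addrI/oppr_inj/eqP; rewrite eqr_nat => /eqP.
by rewrite fsbig_set1.
Qed.

Lemma series_at_neq0 {R : realType} (v : R) (c : nat -> R) (e : R) :
  series_at v c e != 0 -> exists n : nat, e = v - n%:R.
Proof.
apply: contraNP => noe; apply/eqP; apply: fsbig1 => n /= ve.
by case: noe; exists n.
Qed.

Lemma comp_at_neq0 {R : realType} (u w : R) (b a : nat -> R) (e : R) :
  comp_at u b w a e != 0 ->
  exists j m : nat, b j != 0 /\ e = w * (u - j%:R) - m%:R.
Proof.
apply: contraNP => noe; apply/eqP; apply: fsbig1 => -[j m] /= we.
have [->|bj] := eqVneq (b j) 0; first by rewrite mul0r.
by case: noe; exists j, m.
Qed.

(** This isolates the power x^(w (u - n)) when only the pair (n, 0) reaches it;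
    it serves for n = 0, the leading term, and for the least n violating the
    integrality of w n. *)
Lemma comp_at_single {R : realType} (u w : R) (b a : nat -> R) (n : nat) :
  (forall j m : nat, b j != 0 -> w * j%:R + m%:R = w * n%:R ->
     j = n /\ m = 0%N) ->
  comp_at u b w a (w * (u - n%:R)) = b n * a 0%N `^ (u - n%:R).
Proof.
move=> single; rewrite /comp_at -powcoef0.
pose F (p : nat * nat) := b p.1 * powcoef a (u - p.1%:R) p.2.
transitivity (\sum_(p \in [set (n, 0%N)]%classic) F p);
  last by rewrite fsbig_set1.
symmetry; apply: fsbig_widen => [p /= ->|]; first by rewrite /= subr0.
move=> [j m] /= [we jm]; apply/eqP; rewrite mulf_eq0.
have [//|bj /=] := eqVneq (b j) 0; case: jm.
have /single[] : w * j%:R + m%:R = w * n%:R.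
- by move: we; rewrite !mulrBr => we; lra.
- exact: bj.
by move=> -> ->.
Qed.

(** For given j at most one m satisfies w j + m = n, namely m = n - w j, and it
    exists exactly when w j <= n and w j is an integer.  The sum on the right
    also runs over j with w j not an integer, where the truncation is
    meaningless, but there b_j = 0. *)
Lemma comp_at_trunc {R : realType} (u w : R) (b a : nat -> R) (n : nat) :
  0 < w -> (forall j, b j != 0 -> w * j%:R \is a Num.nat) ->
  comp_at u b w a (w * u - n%:R) =
  \sum_(0 <= j < (Num.truncn (n%:R / w)).+1)
     b j * powcoef a (u - j%:R) (Num.truncn (n%:R - w * j%:R)).
Proof.
move=> w0 bint; rewrite /comp_at.
set N := Num.truncn _; pose h j := (j, Num.truncn (n%:R - w * j%:R)).
pose F (p : nat * nat) := b p.1 * powcoef a (u - p.1%:R) p.2.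
have leN j : (j <= N)%N = (w * j%:R <= n%:R).
  rewrite [w * _]mulrC /N truncn_ge_nat ?ler_pdivlMr //.
  by rewrite mul0r.
transitivity (\sum_(p <- [seq h j | j <- index_iota 0 N.+1]) F p); last first.
  by rewrite big_map.
rewrite [RHS]fsbig_seq; last by rewrite map_inj_uniq ?iota_uniq // => i j [].
set s := map h _.
apply: fsbig_widen => [[j m] /= we|[j m] [/= jm nwe]].
  have mE : m%:R = n%:R - w * j%:R by move: we; rewrite mulrBr => we; lra.
  apply/mapP; exists j; last by rewrite /h -mE natrK.
  by rewrite mem_index_iota /= ltnS leN -subr_ge0 -mE.
move: jm nwe => /mapP[i]; rewrite mem_index_iota ltnS leN => len [-> ->] nwe.
have [->|bj] := eqVneq (b i) 0; first by rewrite mul0r.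
case: nwe; rewrite truncnK; first by rewrite mulrBr; lra.
have /natrP[k wk] := bint i bj; move: len; rewrite wk ler_nat => lekn.
by rewrite -natrB // natr_nat.
Qed.

(** * Necessary conditions and the coefficient equations *)

(** Each of the exponents v and w u occurs with a nonzero coefficient on one
    side, hence on the other, where it is at most the leading exponent. *)
Lemma solves_leading {R : realType} (u v w : R) (b c a : nat -> R) :
  b 0%N != 0 -> c 0%N != 0 -> solves u b v c w a ->
  v = w * u /\ b 0%N * a 0%N `^ u = c 0%N.
Proof.
move=> b0 c0 [w0 a0 eqe].
have top : comp_at u b w a (w * u) = b 0%N * a 0%N `^ u.
  have := @comp_at_single _ u w b a 0; rewrite mulr0n subr0; apply=> j m _.
  have wj : 0 <= w * j%:R by rewrite mulr_ge0 // ltW.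
  have m0 : 0 <= m%:R :> R by [].
  rewrite mulr0 => wjm; split; last first.
    by apply/eqP; rewrite -(eqr_nat R); apply/eqP; lra.
  have : w * j%:R == 0 by apply/eqP; lra.
  by rewrite mulf_eq0 gt_eqF //= pnatr_eq0 => /eqP.
have lead : series_at v c v = c 0%N.
  by rewrite -[RHS](series_at_nat v c) mulr0n subr0.
have vE : v = w * u.
  apply/eqP; rewrite eq_le; apply/andP; split.
    have : comp_at u b w a v != 0 by rewrite eqe lead.
    case/comp_at_neq0 => j [m [_ ->]].
    have := mulr_ge0 (ltW w0) (ler0n R j); have := ler0n R m.
    by rewrite mulrBr; lra.
  have : series_at v c (w * u) != 0.
    by rewrite -eqe top mulf_neq0 // gt_eqF // powR_gt0.
  by case/series_at_neq0 => n ->; have := ler0n R n; lra.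
by split=> //; rewrite -top eqe -vE.
Qed.

(** Strong induction: if w j is an integer for all j < n with b_j <> 0 but w n
    is not, then no pair (j, m) with j < n and b_j <> 0 reaches the exponent
    w (u - n), so B(A) has the nonzero coefficient b_n a_0^(u-n) there; but
    w u - w n is not of the form v - k. *)
Lemma solves_integral {R : realType} (u v w : R) (b c a : nat -> R) :
  v = w * u -> solves u b v c w a ->
  forall j, b j != 0 -> w * j%:R \is a Num.nat.
Proof.
move=> vE [w0 a0 eqe]; elim/ltn_ind => n IH bn; apply: contraT => nint.
have : comp_at u b w a (w * (u - n%:R)) != 0.
  rewrite comp_at_single; first by rewrite mulf_neq0 // gt_eqF // powR_gt0.
  move=> j m bj wjm.
  have [ltjn|ltnj|jn] := ltngtP j n.
  - case/negP: nint; rewrite -wjm; apply: rpredD; last exact: natr_nat.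
    exact: IH.
  - have wnj : w * n%:R < w * j%:R by rewrite ltr_pM2l // ltr_nat.
    by exfalso; have m0 := ler0n R m; lra.
  - split=> //; apply/eqP; rewrite -(eqr_nat R); apply/eqP.
    by move: wjm; rewrite jn; lra.
rewrite eqe => /series_at_neq0[k]; rewrite vE mulrBr => wn.
by case/negP: nint; have -> : w * n%:R = k%:R by lra.
Qed.

(** Integrality of w j puts every exponent of B(A) in the set of the v - n with
    n a natural number, so no equation is lost by looking at these exponents
    only. *)
Lemma solvesP {R : realType} (u v w : R) (b c a : nat -> R) :
  0 < w -> 0 < a 0%N -> v = w * u ->
  (forall j, b j != 0 -> w * j%:R \is a Num.nat) ->
  solves u b v c w a <->
  forall n : nat,
    \sum_(0 <= j < (Num.truncn (n%:R / w)).+1)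
      b j * powcoef a (u - j%:R) (Num.truncn (n%:R - w * j%:R)) = c n.
Proof.
move=> w0 a0 vE bint; split=> [[_ _ eqe] n|eqn].
  by rewrite -comp_at_trunc // -vE eqe series_at_nat.
split=> // e; case: (pselect (exists n : nat, e = v - n%:R)) => [[n ->]|noe].
  by rewrite series_at_nat vE comp_at_trunc.
have -> : series_at v c e = 0.
  by apply/eqP; apply: contraPT noe => /series_at_neq0[k ->] []; exists k.
apply/eqP; apply: contraPT noe => /comp_at_neq0[j [m [bj ->]]] [].
have /natrP[k wk] := bint j bj.
by exists (k + m)%N; rewrite vE mulrBr wk natrD; ring.
Qed.

(** * Solving for the next coefficient *)

Definition next_coef {R : realType}
    (u w : R) (b c a : nat -> R) (n : nat) : R :=
  - (a 0%N / (b 0%N * u * powcoef a u 0)) *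
    (\sum_(1 <= j < (Num.truncn (n%:R / w)).+1)
        b j * powcoef a (u - j%:R) (Num.truncn (n%:R - w * j%:R))
     + b 0%N / (n%:R * a 0%N) *
       \sum_(1 <= k < n)
         (k%:R * (1 + u) - n%:R) * a k * powcoef a u (n - k)
     - c n).

(** By [powcoef_rec], a_n enters P_n(u) only through the summand k = n, whose
    factor n (1 + u) - n = n u is nonzero. *)
Lemma next_coefP {R : realType} (u w : R) (b c a : nat -> R) (n : nat) :
  u != 0 -> b 0%N != 0 -> 0 < a 0%N -> (0 < n)%N ->
  (\sum_(0 <= j < (Num.truncn (n%:R / w)).+1)
     b j * powcoef a (u - j%:R) (Num.truncn (n%:R - w * j%:R)) = c n)
  <-> a n = next_coef u w b c a n.
Proof.
move=> u0 b0 a0 n0; rewrite /next_coef big_ltn // mulr0 !subr0 natrK.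
set rest := \sum_(1 <= j < _) _.
rewrite powcoef_rec ?gt_eqF // big_nat_recr //= subnn.
set low := \sum_(1 <= k < n) _.
have P0 : powcoef a u 0 != 0 by rewrite powcoef0 gt_eqF // powR_gt0.
have n0' : n%:R != 0 :> R by rewrite pnatr_eq0 -lt0n.
have a0' : a 0%N != 0 by rewrite gt_eqF.
move: (powcoef a u 0) P0 => P P0.
have -> : b 0%N * ((n%:R * a 0%N)^-1 *
    (low + (n%:R * (1 + u) - n%:R) * a n * P)) + rest =
    rest + b 0%N / (n%:R * a 0%N) * low + (b 0%N * u * P / a 0%N) * a n.
  by field; rewrite n0' a0'.
set k := b 0%N * u * P.
have k0 : k != 0 by do !apply: mulf_neq0.
set X := rest + _.
split=> [<-|->]; by field; rewrite ?a0' ?k0.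
Qed.

(** Since w > 0, the terms with j >= 1 involve P_m for m < n only. *)
Lemma next_coef_local {R : realType} (u w : R) (b c a a' : nat -> R) (n : nat) :
  0 < w -> (0 < n)%N -> (forall i, (i < n)%N -> a i = a' i) ->
  next_coef u w b c a n = next_coef u w b c a' n.
Proof.
move=> w0 n0 aa'.
have ext r m : (m < n)%N -> powcoef a r m = powcoef a' r m.
  move=> ltmn; apply: powcoef_ext => i leim.
  by rewrite aa' // (leq_ltn_trans leim).
rewrite /next_coef aa' // ext //; congr (_ * (_ + _ * _ - _)).
  apply: eq_big_nat => j /andP[j0 _]; congr (_ * _); apply: ext.
  have lt : n%:R - w * j%:R < n%:R by rewrite gtrBl mulr_gt0 // ltr0n.
  have [ge0|lt0] := leP 0 (n%:R - w * j%:R); first by rewrite truncn_lt_nat.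
  by rewrite (_ : Num.truncn _ = 0%N) //; apply/truncn0Pn; rewrite -ltNge; lra.
apply: eq_big_nat => k /andP[k0 ltkn]; rewrite aa' // ext //.
by rewrite ltn_subrL k0 n0.
Qed.

(** * Existence of a solution and solvability *)

(** g n tabulates the values at indices below n; locality of F makes the
    diagonal values independent of the table they were computed from. *)
Lemma course_of_values {T : Type} (x0 : T) (F : (nat -> T) -> nat -> T) :
  (forall n s s', (forall i, (i < n)%N -> s i = s' i) -> F s n = F s' n) ->
  exists s : nat -> T, forall n, s n = F s n.
Proof.
move=> Floc.
pose g := fix g n : nat -> T := if n is m.+1 then
  fun i => if i == m then F (g m) m else g m i else fun=> x0.
have gE n i : (i < n)%N -> g n i = F (g i) i.
  elim: n => // n IH; rewrite ltnS leq_eqVlt => /orP[/eqP ->|ltin] /=.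
    by rewrite eqxx.
  by rewrite ltn_eqF // IH.
exists (fun n => F (g n) n) => n; apply: Floc => i ltin; exact: gE.
Qed.

Lemma sgr_div_gt0 {R : realType} (x y : R) :
  Num.sg x = Num.sg y -> y != 0 -> 0 < x / y.
Proof.
by move=> sxy y0; rewrite -sgr_gt0 sgrM sgrV sxy -expr2 sqr_sg y0 ltr01.
Qed.

Lemma solves_exists {R : realType} (u v : R) (b c : nat -> R) :
  b 0%N != 0 -> u != 0 -> 0 < v / u ->
  (forall j, b j != 0 -> v / u * j%:R \is a Num.nat) ->
  0 < c 0%N / b 0%N ->
  exists a : nat -> R, solves u b v c (v / u) a.
Proof.
move=> b0 u0 w0 bint cb0; set w := v / u in w0 bint *.
pose F s n := if n == 0%N then (c 0%N / b 0%N) `^ u^-1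
              else next_coef u w b c s n.
have [|a aE] := @course_of_values _ 0 F.
  move=> [|n] s s' ss' //; rewrite /F /=; exact: next_coef_local.
have a0E : a 0%N = (c 0%N / b 0%N) `^ u^-1 by rewrite aE.
have a0 : 0 < a 0%N by rewrite a0E powR_gt0.
have vE : v = w * u by rewrite divfK.
exists a; apply/(solvesP _ _ _ _ _ _ w0 a0 vE bint) => -[|n].
  rewrite mul0r truncn0 big_nat1 subr0 mulr0 subr0 truncn0 powcoef0 a0E.
  by rewrite -powRrM mulVf // powRr1 ?ltW // mulrC divfK.
by apply/next_coefP => //; rewrite aE.
Qed.

(* Rationality of v / u in (1) is required unless B is the single monomial
   b_0 x^u: for B(x) = x and C(x) = x^v with v > 0 irrational, A = C is a
   solution although v / u = v is irrational. *)
Theorem theorem2p3 (R : realType) (u v : R) (b c : nat -> R)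
    (hb0 : b 0%N != 0) (hc0 : c 0%N != 0) (hu : u != 0) :
  ((exists (w : R) (a : nat -> R), solves u b v c w a) <->
   [/\ Num.sg u = Num.sg v /\
         (is_rational (v / u) \/ (forall n : nat, (1 <= n)%N -> b n = 0)),
       (forall n : nat, (1 <= n)%N ->
          ~ is_pos_integer (n%:R * (v / u)) -> b n = 0) &
       Num.sg (b 0%N) = Num.sg (c 0%N)]) /\
  (forall (w : R) (a : nat -> R), solves u b v c w a ->
     [/\ w = v / u,
         a 0%N = (c 0%N / b 0%N) `^ u^-1,
         (* a nonzero b_j has w j integral, so that truncn is exact there *)
         (forall n : nat, (1 <= n)%N ->
            a n = - (a 0%N / (b 0%N * u * powcoef a u 0)) *
              (\sum_(1 <= j < (Num.truncn (n%:R / w)).+1)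
                  b j * powcoef a (u - j%:R) (Num.truncn (n%:R - w * j%:R))
               + b 0%N / (n%:R * a 0%N) *
                 \sum_(1 <= k < n)
                   (k%:R * (1 + u) - n%:R) * a k * powcoef a u (n - k)
               - c n)) &
         (forall r : R,
            powcoef a r 0 = a 0%N `^ r /\
            (forall n : nat, (1 <= n)%N ->
               powcoef a r n = (n%:R * a 0%N)^-1 *
                 \sum_(1 <= k < n.+1)
                   (k%:R * (1 + r) - n%:R) * a k * powcoef a r (n - k)))]).
Proof.
split; first split.
- move=> [w [a sol]]; have [vE lead] := solves_leading _ _ _ _ _ _ hb0 hc0 sol.
  have bint := solves_integral _ _ _ _ _ _ vE sol; case: sol => w0 a0 _.
  have -> : v / u = w by rewrite vE mulfK.
  split; first split.
  + by rewrite vE sgrM (gtr0_sg w0) mul1r.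
  + have [|nall] := pselect (forall n : nat, (1 <= n)%N -> b n = 0).
      by right.
    left; have [n n0 bn] : exists2 n : nat, (1 <= n)%N & b n != 0.
      apply/not_exists2P => nex; apply: nall => n n0.
      by have [//|/negP/negPn/eqP] := nex n.
    have /natrP[k wk] := bint n bn; exists (k%:R / n%:R).
    by rewrite fmorph_div /= !ratr_nat -wk mulfK // pnatr_eq0 -lt0n.
  + move=> n n0 nint; apply/eqP; apply: contraPT nint => bn; apply.
    have /natrP[k wk] := bint n bn; exists k; last by rewrite mulrC.
    by rewrite -(ltr0n R) -wk mulr_gt0 // ltr0n.
  + by rewrite -lead sgrM [Num.sg (_ `^ _)]gtr0_sg ?mulr1 // powR_gt0.
- move=> [[sguv _] integ sgbc].
  have w0 : 0 < v / u by apply: sgr_div_gt0.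
  exists (v / u); apply: solves_exists => //; last exact: sgr_div_gt0.
  move=> [|j] bj; first by rewrite mulr0 (natr_nat R 0).
  have [[k _ jk]|nint] := pselect (is_pos_integer (j.+1%:R * (v / u))).
    by rewrite mulrC jk natr_nat.
  by rewrite integ ?eqxx in bj.
- move=> w a sol; have [vE lead] := solves_leading _ _ _ _ _ _ hb0 hc0 sol.
  have bint := solves_integral _ _ _ _ _ _ vE sol; have [w0 a0 _] := sol.
  have /(solvesP _ _ _ _ _ _ w0 a0 vE bint) eqn := sol.
  split.
  + by rewrite vE mulfK.
  + by rewrite -lead mulrAC divff // mul1r -powRrM mulfV // powRr1 // ltW.
  + by move=> n n0; apply/next_coefP.
  + move=> r; split; first exact: powcoef0.
    by move=> n n0; apply: powcoef_rec => //; rewrite gt_eqF.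
Qed.
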